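(* Let $G$ be a topological group and let $\Delta=\{(h,h)\in G\times G: h\in G\}$ be the diagonal subgroup. Then the map $$\Theta\colon \Delta\backslash(G\times G)\to G,\qquad \Theta\big(\Delta(g,f)\big)=g^{-1}f,$$ defines a bijective coarse equivalence between the quotient coarse structure $\mathcal E_q\big(\Delta\backslash(G\times G)\big)$ and the Roelcke coarse structure $\mathcal E_\wedge(G)$.
   Context: A coarse structure on a set $X$ is an ideal $\mathcal E$ of subsets of $X\times X$ (closed under subsets and finite unions) containing the diagonal and closed under transposition and composition $E\circ F=\{(x,z): \exists y\ (x,y)\in E,\ (y,z)\in F\}$. A pseudometric $d$ on $X$ induces $\mathcal E_d(X)=\{E\subseteq X\times X:\sup_{(x,y)\in E}d(x,y)<\infty\}$. A map $\phi\colon(X,\mathcal E)\to(Y,\mathcal F)$ is controlled if $(\phi\times\phi)[E]\in\mathcal F$ for all $E\in\mathcal E$. A bijective coarse equivalence is a bijection $\phi$ such that both $\phi$ and $\phi^{-1}$ are controlled. For a topological group $G$, the left coarse structure is $\mathcal E_L(G)=\bigcap_d\mathcal E_d(G)$ and the right coarse structure is $\mathcal E_R(G)=\bigcap_d\mathcal E_{\check d}(G)$, where $d$ ranges over all continuous left-invariant pseudometrics on $G$ and $\check d(g,f)=d(g^{-1},f^{-1})$. The Roelcke coarse structure $\mathcal E_\wedge(G)=\mathcal E_L(G)\wedge\mathcal E_R(G)$ is the coarse structure generated by (i.e., the smallest one containing) $\mathcal E_L(G)\cup\mathcal E_R(G)$. For a subgroup $K$ of a topological group $\Gamma$, $K\backslash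 \Gamma$ is the set of right cosets $Kg$, and $\mathcal E_q(K\backslash \Gamma)$ is the smallest coarse structure on $K\backslash\Gamma$ for which the map $(\Gamma,\mathcal E_L(\Gamma))\to K\backslash\Gamma$, $g\mapsto Kg$, is controlled; this is applied with $\Gamma=G\times G$ (product topology) and $K=\Delta$. *)

(* Defs.v *)
From HB Require Import structures.
From mathcomp Require Import all_boot all_order all_algebra.
From mathcomp Require Import all_classical all_reals.
From mathcomp Require Import ereal topology.

Set Implicit Arguments.
Unset Strict Implicit.
Unset Printing Implicit Defensive.

Import Order.TTheory GRing.Theory Num.Theory.
Import numFieldTopology.Exports.

Local Open Scope classical_set_scope.
Local Open Scope ring_scope.

(* No separation axiom is imposed. *)
HB.mixin Record isTopologicalGroup G & Topological G & Group G := {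
  mulg_continuous : continuous (fun x : G * G => (x.1 * x.2)%g);
  invg_continuous : continuous (fun x : G => (x^-1)%g)
}.

#[short(type="topologicalGroupType")]
HB.structure Definition TopologicalGroup :=
  {G of Topological G & Group G & isTopologicalGroup G}.

Section ProductTopologicalGroup.
Variables G H : topologicalGroupType.

Lemma prod_mulg_continuous :
  continuous (fun x : (G * H) * (G * H) => (x.1 * x.2)%g).
Proof.
move=> x; apply: cvg_pair => /=.
- apply: (@continuous_comp _ _ _
    (fun x : (G * H) * (G * H) => (x.1.1, x.2.1)) (fun p => (p.1 * p.2)%g));
    last exact: mulg_continuous.
  apply: cvg_pair; apply: continuous_comp; try exact: cvg_fst;
    exact: cvg_snd.
- apply: (@continuous_comp _ _ _
    (fun x : (G * H) * (G * H) => (x.1.2, x.2.2)) (fun p => (p.1 * p.2)%g));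
    last exact: mulg_continuous.
  apply: cvg_pair; apply: continuous_comp; try exact: cvg_fst;
    exact: cvg_snd.
Qed.

Lemma prod_invg_continuous : continuous (fun x : G * H => (x^-1)%g).
Proof.
move=> x; apply: cvg_pair => /=.
- by apply: continuous_comp; [exact: cvg_fst|exact: invg_continuous].
- by apply: continuous_comp; [exact: cvg_snd|exact: invg_continuous].
Qed.

HB.instance Definition _ := isTopologicalGroup.Build (G * H)%type
  prod_mulg_continuous prod_invg_continuous.

End ProductTopologicalGroup.

Section CoarseStructures.

(* The relational composition of the library is written in functional order,
   (F \; E)%relation = {(x, z) | exists y, (x, y) in E and (y, z) in F}. *)
Record coarse_structure (X : Type) (E : set (set (X * X))) : Prop := {
  coarse_subset : forall A B, A `<=` B -> E B -> E A;
  coarse_setU : forall A B, E A -> E B -> E (A `|` B);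
  coarse_diagonal : E diagonal;
  coarse_inv : forall A, E A -> E (A^-1)%relation;
  coarse_comp : forall A B, E A -> E B -> E (B \; A)%relation
}.

Definition controlled (X Y : Type) (E : set (set (X * X)))
    (F : set (set (Y * Y))) (phi : X -> Y) : Prop :=
  forall A, E A -> F [set (phi p.1, phi p.2) | p in A].

Definition bijective_coarse_equivalence (X Y : Type) (E : set (set (X * X)))
    (F : set (set (Y * Y))) (phi : X -> Y) : Prop :=
  exists psi : Y -> X,
    [/\ cancel phi psi, cancel psi phi, controlled E F phi
      & controlled F E psi].

(* Pseudometrics are plain functions here, as pseudoMetricType attaches a
   single one to a type. *)
Record pseudometric (R : realType) (X : Type) (d : X -> X -> R) : Prop := {
  pseudometric_ge0 : forall x y, 0 <= d x y;
  pseudometric_refl : forall x, d x x = 0;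
  pseudometric_sym : forall x y, d x y = d y x;
  pseudometric_triangle : forall x y z, d x z <= d x y + d y z
}.

(* The supremum over the empty set is -oo. *)
Definition pseudometric_coarse (R : realType) (X : Type) (d : X -> X -> R) :
    set (set (X * X)) :=
  [set A | (ereal_sup [set (d p.1 p.2)%:E | p in A] < +oo)%E].

Lemma pseudometric_coarseP (R : realType) (X : Type) (d : X -> X -> R)
    (A : set (X * X)) :
  pseudometric_coarse d A <-> exists M, forall x y, A (x, y) -> d x y <= M.
Proof.
split=> [supA|[M dM]].
- have ubA x y : A (x, y) ->
      ((d x y)%:E <= ereal_sup [set (d p.1 p.2)%:E | p in A])%E.
    by move=> Axy; apply: ereal_sup_ubound; exists (x, y).
  move: supA ubA; rewrite /pseudometric_coarse /=.
  case: (ereal_sup _) => [M _ ubA|//|_ ubA].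
    by exists M => x y /ubA; rewrite lee_fin.
  by exists 0 => x y /ubA; rewrite leeNy_eq.
- apply: (@le_lt_trans _ _ M%:E); last exact: ltry.
  by apply: ge_ereal_sup => _ [[x y] Axy <-]; rewrite lee_fin; exact: dM.
Qed.

Lemma coarse_structure_pseudometric (R : realType) (X : Type)
    (d : X -> X -> R) :
  pseudometric d -> coarse_structure (pseudometric_coarse d).
Proof.
move=> dP; split.
- move=> A B AB /pseudometric_coarseP[M dM]; apply/pseudometric_coarseP.
  by exists M => x y /AB; exact: dM.
- move=> A B /pseudometric_coarseP[M dM] /pseudometric_coarseP[N dN].
  apply/pseudometric_coarseP; exists (Num.max M N) => x y.
  by move=> [/dM|/dN] dxy; rewrite le_max dxy ?orbT.
- apply/pseudometric_coarseP; exists 0 => x y /diagonalP ->.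
  by rewrite (pseudometric_refl dP).
- move=> A /pseudometric_coarseP[M dM]; apply/pseudometric_coarseP.
  by exists M => x y; rewrite (pseudometric_sym dP); exact: dM.
- move=> A B /pseudometric_coarseP[M dM] /pseudometric_coarseP[N dN].
  apply/pseudometric_coarseP; exists (M + N) => x z [y Axy Byz].
  apply: (le_trans (pseudometric_triangle dP x y z)).
  by apply: lerD; [exact: dM|exact: dN].
Qed.

Lemma coarse_structure_bigcap (I X : Type) (D : set I)
    (E : I -> set (set (X * X))) :
  (forall i, D i -> coarse_structure (E i)) ->
  coarse_structure (\bigcap_(i in D) E i).
Proof.
move=> EP; split.
- by move=> A B AB EB i Di; apply: (coarse_subset (EP i Di) AB); exact: EB.
- by move=> A B EA EB i Di; apply: (coarse_setU (EP i Di)); [exact: EA|exact: EB].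
- by move=> i Di; exact: (coarse_diagonal (EP i Di)).
- by move=> A EA i Di; apply: (coarse_inv (EP i Di)); exact: EA.
- by move=> A B EA EB i Di; apply: (coarse_comp (EP i Di)); [exact: EA|exact: EB].
Qed.

End CoarseStructures.

Section GroupCoarseStructures.
Variables (R : realType) (G : topologicalGroupType).

Record continuous_left_invariant_pseudometric (d : G -> G -> R) : Prop := {
  cli_pseudometric : pseudometric d;
  cli_continuous : continuous (fun p : G * G => d p.1 p.2);
  cli_left_invariant : forall h g f, d (h * g)%g (h * f)%g = d g f
}.

Definition left_coarse : set (set (G * G)) :=
  \bigcap_(d in continuous_left_invariant_pseudometric) pseudometric_coarse d.

Definition right_coarse : set (set (G * G)) :=
  \bigcap_(d in continuous_left_invariant_pseudometric)
    pseudometric_coarse (fun g f => d (g^-1)%g (f^-1)%g).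

Definition roelcke_coarse : set (set (G * G)) :=
  smallest (@coarse_structure G) (left_coarse `|` right_coarse).

Lemma coarse_structure_left : coarse_structure left_coarse.
Proof.
apply: coarse_structure_bigcap => d dP.
exact: coarse_structure_pseudometric (cli_pseudometric dP).
Qed.

Lemma coarse_structure_right : coarse_structure right_coarse.
Proof.
apply: coarse_structure_bigcap => d /cli_pseudometric dP.
apply: coarse_structure_pseudometric; split=> *.
- exact: pseudometric_ge0.
- exact: pseudometric_refl.
- exact: pseudometric_sym.
- exact: pseudometric_triangle.
Qed.

Lemma coarse_structure_roelcke : coarse_structure roelcke_coarse.
Proof. by apply: coarse_structure_bigcap => E []. Qed.

Section Quotient.
Variable K : groupClosed G.

Definition right_coset (g : G) : set G := [set (k * g)%g | k in [set` K]].

Definition right_cosets : set (set G) := range right_coset.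

(* The coset space is the set right_cosets coerced to a type by set_type. *)
Definition to_right_cosets (g : G) : right_cosets :=
  exist _ (right_coset g) (mem_set (imageT right_coset g)).

Definition quotient_coarse : set (set (right_cosets * right_cosets)) :=
  \bigcap_(F in [set F | coarse_structure F
                         /\ controlled left_coarse F to_right_cosets]) F.

Lemma coarse_structure_quotient : coarse_structure quotient_coarse.
Proof. by apply: coarse_structure_bigcap => F []. Qed.

Lemma controlled_to_right_cosets :
  controlled left_coarse quotient_coarse to_right_cosets.
Proof. by move=> A EA F [_ +]; apply. Qed.

Lemma quotient_coarse_smallest (F : set (set (right_cosets * right_cosets))) :
  coarse_structure F -> controlled left_coarse F to_right_cosets ->
  quotient_coarse `<=` F.
Proof. by move=> cF pF A; apply. Qed.

End Quotient.

End GroupCoarseStructures.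
Arguments left_coarse : clear implicits.
Arguments right_coarse : clear implicits.
Arguments roelcke_coarse : clear implicits.
Arguments quotient_coarse R {G} K _.

Section DiagonalSubgroup.
Variable G : groupType.

Definition diagonal_subgroup : {pred G * G} :=
  mem (range (fun h : G => (h, h))).

Lemma diagonal_subgroupP (p : G * G) :
  reflect (range (fun h : G => (h, h)) p) (p \in diagonal_subgroup).
Proof. exact: asboolP. Qed.

Fact diagonal_subgroup1 : (1%g : G * G) \in diagonal_subgroup.
Proof. by apply/diagonal_subgroupP; exists 1%g. Qed.

Fact diagonal_subgroupM : mulg_closed diagonal_subgroup.
Proof.
move=> _ _ /diagonal_subgroupP[x _ <-] /diagonal_subgroupP[y _ <-].
by apply/diagonal_subgroupP; exists (x * y)%g.
Qed.

Fact diagonal_subgroupV : invg_closed diagonal_subgroup.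
Proof.
move=> _ /diagonal_subgroupP[x _ <-].
by apply/diagonal_subgroupP; exists (x^-1)%g.
Qed.

(* The instances are stated at groupType so that they share one parameter. *)
Let GG : groupType := (G * G)%type.
HB.instance Definition _ := isMulClosed.Build GG diagonal_subgroup
  diagonal_subgroupM.
HB.instance Definition _ := isMul1Closed.Build GG diagonal_subgroup
  diagonal_subgroup1.
HB.instance Definition _ := isInvClosed.Build GG diagonal_subgroup
  diagonal_subgroupV.

End DiagonalSubgroup.
Arguments diagonal_subgroup : clear implicits.

(* Main.v *)
(** By minimality of the generated coarse structures, it suffices to control
    the map (g, f) |-> g^-1 f on E_L(G x G), and x |-> Delta(1, x) on E_L(G)
    and E_R(G) separately.  If (g, g') and (f, f') are E_L-close, then g^-1 f
    and g^-1 f' are E_L-close by left invariance, while g^-1 f' and g'^-1 f'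
    are E_R-close since their inverses are f'^-1 g and f'^-1 g'.  Conversely,
    continuous homomorphisms are controlled for the left coarse structures;
    x |-> (1, x) handles E_L(G) and x |-> (x, 1) handles E_R(G), because
    Delta(1, x) = Delta(x^-1, 1). *)
Require Import Defs.
From mathcomp Require Import all_boot all_order all_algebra.
From mathcomp Require Import all_classical all_reals.
From mathcomp Require Import ereal topology.

Set Implicit Arguments.
Unset Strict Implicit.
Unset Printing Implicit Defensive.

Import numFieldTopology.Exports.

Local Open Scope classical_set_scope.
Local Open Scope group_scope.

(** The pullback of [F] along [phi] serves as the competitor in minimality arguments: a generated
    structure lies in it as soon as its generators do. For composites an inclusion suffices, as
    [phi] need not be injective. *)
Lemma coarse_structure_preimage (X Y : Type) (F : set (set (Y * Y)))
    (phi : X -> Y) : coarse_structure F ->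
  coarse_structure [set A | F [set (phi p.1, phi p.2) | p in A]].
Proof.
move=> cF; split=> /=.
- by move=> A B AB; apply: (coarse_subset cF); exact: image_subset.
- by move=> A B FA FB; rewrite image_setU; exact: (coarse_setU cF).
- apply: (coarse_subset cF _ (coarse_diagonal cF)).
  by move=> _ [[x y] /diagonalP-> <-]; apply/diagonalP.
- move=> A FA; apply: (coarse_subset cF _ (coarse_inv cF FA)).
  by move=> _ [[x y] Ayx <-]; exists (y, x).
- move=> A B FA FB; apply: (coarse_subset cF _ (coarse_comp cF FA FB)).
  move=> _ [[x z] [y Axy Byz] <-].
  by exists (phi y); [exists (x, y)|exists (y, z)].
Qed.

Lemma roelcke_coarse_controlled (R : realType) (G : topologicalGroupType)
    (Y : Type) (F : set (set (Y * Y))) (phi : G -> Y) :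
  coarse_structure F -> controlled (left_coarse R G) F phi ->
  controlled (right_coarse R G) F phi ->
  controlled (roelcke_coarse R G) F phi.
Proof.
move=> cF Lphi Rphi A /(_ [set B | F [set (phi p.1, phi p.2) | p in B]]).
apply; split; first exact: coarse_structure_preimage cF.
by move=> B [/Lphi|/Rphi].
Qed.

Lemma quotient_coarse_controlled (R : realType) (G : topologicalGroupType)
    (K : groupClosed G) (Y : Type) (F : set (set (Y * Y)))
    (phi : right_cosets K -> Y) :
  coarse_structure F ->
  controlled (left_coarse R G) F (phi \o to_right_cosets K) ->
  controlled (quotient_coarse R K) F phi.
Proof.
move=> cF Lphi A /(_ [set B | F [set (phi p.1, phi p.2) | p in B]]).
apply; split; first exact: coarse_structure_preimage cF.
by move=> B /Lphi; rewrite /= image_comp.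
Qed.

(** Each continuous left-invariant pseudometric on [H] pulls back along [phi] to one on [G], and its
    bound on [A] is the bound sought on the image. *)
Lemma left_coarse_hom (R : realType) (G H : topologicalGroupType)
    (phi : G -> H) :
  continuous phi -> {morph phi : x y / x * y} ->
  controlled (left_coarse R G) (left_coarse R H) phi.
Proof.
move=> cphi phiM A LA d [dP dC dL].
have /LA/pseudometric_coarseP[M dM] :
    continuous_left_invariant_pseudometric (fun x y => d (phi x) (phi y)).
  split=> [|p|h g f]; last by rewrite !phiM dL.
    split=> *; [exact: (pseudometric_ge0 dP)|exact: (pseudometric_refl dP)
      |exact: (pseudometric_sym dP)|exact: (pseudometric_triangle dP)].
  apply: (@continuous_comp _ _ _ (fun p : G * G => (phi p.1, phi p.2))
    (fun q : H * H => d q.1 q.2)); last exact: dC.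
  by apply: cvg_pair; apply: continuous_comp;
    [exact: cvg_fst|exact: cphi|exact: cvg_snd|exact: cphi].
by apply/pseudometric_coarseP; exists M => _ _ [[x y] /dM dxy [<- <-]].
Qed.

(** Indexing the pairs lets the translating element [h i] vary from pair to pair; the bound [M] is
    unchanged. *)
Lemma left_coarse_translate (R : realType) (G : topologicalGroupType)
    (I : Type) (D : set I) (h g f : I -> G) :
  left_coarse R G [set (g i, f i) | i in D] ->
  left_coarse R G [set (h i * g i, h i * f i) | i in D].
Proof.
move=> LD d dP; have /pseudometric_coarseP[M dM] := LD d dP.
apply/pseudometric_coarseP; exists M => _ _ [i Di [<- <-]].
by rewrite (cli_left_invariant dP); apply: dM; exists i.
Qed.

Lemma right_coarseE (R : realType) (G : topologicalGroupType)
    (A : set (G * G)) :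
  right_coarse R G A <-> left_coarse R G [set (p.1^-1, p.2^-1) | p in A].
Proof.
by split=> + d dP => /(_ d dP); rewrite /pseudometric_coarse /= image_comp.
Qed.

Lemma to_right_cosetsM (G : topologicalGroupType) (K : groupClosed G)
    (k g : G) : k \in K -> to_right_cosets K (k * g) = to_right_cosets K g.
Proof.
move=> Kk; apply: val_inj; apply/seteqP; split=> _ [l Kl <-] /=.
  by exists (l * k); rewrite /= ?gpredM ?mulgA.
by exists (l * k^-1); rewrite /= ?divgKA ?gpredM ?gpredV.
Qed.

Lemma to_right_cosets_surj (G : topologicalGroupType) (K : groupClosed G)
    (c : right_cosets K) : exists g, to_right_cosets K g = c.
Proof. by have /set_mem[g _ gc] := valP c; exists g; exact: val_inj. Qed.

Lemma to_right_cosets_eq (G : topologicalGroupType) (K : groupClosed G)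
    (g f : G) : to_right_cosets K g = to_right_cosets K f ->
  exists2 k, k \in K & k * f = g.
Proof.
move=> /(congr1 val) /= gf.
(* As [1] is in [K], [g] lies in its own coset, hence in that of [f]. *)
have : right_coset K g g by exists 1; rewrite ?mul1g//=; exact: gpred1.
by rewrite gf => -[k Kk <-]; exists k.
Qed.

Lemma to_right_cosets_diagonal (G : topologicalGroupType) (g f : G) :
  to_right_cosets (diagonal_subgroup G) (1, g^-1 * f) =
  to_right_cosets (diagonal_subgroup G) (g, f).
Proof.
rewrite -(@to_right_cosetsM _ _ (g, g) (1, g^-1 * f)).
  by congr to_right_cosets; congr pair; rewrite /= ?mulg1 ?mulVKg.
by apply/diagonal_subgroupP; exists g.
Qed.

Lemma invmul_controlled (R : realType) (G : topologicalGroupType) :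
  controlled (left_coarse R (G * G)%type) (roelcke_coarse R G)
    (fun p : G * G => p.1^-1 * p.2).
Proof.
move=> A LA; have cW := coarse_structure_roelcke R G.
have LA1 : left_coarse R G [set (p.1.1, p.2.1) | p in A].
  by apply: (left_coarse_hom (phi := fst)) LA => // p; exact: cvg_fst.
have LA2 : left_coarse R G [set (p.1.2, p.2.2) | p in A].
  by apply: (left_coarse_hom (phi := snd)) LA => // p; exact: cvg_snd.
(* One coordinate changes at a time: [B] moves the second and [C] the first, meeting at
   [p.1.1^-1 * p.2.2]. *)
pose B := [set (p.1.1^-1 * p.1.2, p.1.1^-1 * p.2.2) | p in A].
pose C := [set (p.1.1^-1 * p.2.2, p.2.1^-1 * p.2.2) | p in A].
have WB : roelcke_coarse R G B.
  by apply: sub_gen_smallest; left;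
    exact: (left_coarse_translate (fun p => p.1.1^-1) LA2).
have WC : roelcke_coarse R G C.
  apply: sub_gen_smallest; right; apply/right_coarseE; rewrite image_comp /=.
  (* Inverting the pairs of [C] makes [p.2.2^-1] a common left factor, so they are translates of the
     pairs in [LA1]. *)
  under eq_imagel do rewrite /= !invgM !invgK.
  exact: (left_coarse_translate (fun p => p.2.2^-1) LA1).
apply: (coarse_subset cW _ (coarse_comp cW WB WC)) => _ [p Ap <-].
by exists (p.1.1^-1 * p.2.2); exists p.
Qed.

Lemma to_diagonal_cosets_controlled (R : realType) (G : topologicalGroupType) :
  controlled (roelcke_coarse R G) (quotient_coarse R (diagonal_subgroup G))
    (fun x => to_right_cosets (diagonal_subgroup G) (1, x)).
Proof.
have cQ := coarse_structure_quotient R (diagonal_subgroup G).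
have ctrl := @controlled_to_right_cosets R _ (diagonal_subgroup G).
apply: roelcke_coarse_controlled => // A.
- have hom : controlled (left_coarse R G) (left_coarse R (G * G)%type)
      (fun x : G => (1, x)).
    apply: left_coarse_hom => [x|x y]; last by congr pair; rewrite /= mulg1.
    by apply: cvg_pair; [exact: cvg_cst|exact: cvg_id].
  by move=> /hom/ctrl; rewrite image_comp.
- have hom : controlled (left_coarse R G) (left_coarse R (G * G)%type)
      (fun x : G => (x, 1)).
    apply: left_coarse_hom => [x|x y]; last by congr pair; rewrite /= mulg1.
    by apply: cvg_pair; [exact: cvg_id|exact: cvg_cst].
  (* Passing to [left_coarse] inverts the pairs, so the embedding is evaluated at [x^-1]; [cosetV]
     undoes this. *)
  move=> /right_coarseE/hom/ctrl; rewrite !image_comp /=.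
  have cosetV x : to_right_cosets (diagonal_subgroup G) (x^-1, 1) =
                  to_right_cosets (diagonal_subgroup G) (1, x).
    by rewrite -to_right_cosets_diagonal invgK mulg1.
  by under eq_imagel do rewrite /= !cosetV.
Qed.

Theorem theorem4 (R : realType) (G : topologicalGroupType) :
  exists Theta : right_cosets (diagonal_subgroup G) -> G,
    (forall g f : G,
       Theta (to_right_cosets (diagonal_subgroup G) (g, f)) = (g^-1 * f)%g) /\
    bijective_coarse_equivalence
      (quotient_coarse R (diagonal_subgroup G)) (roelcke_coarse R G) Theta.
Proof.
(* [Theta] is defined through chosen representatives. The choice does not matter, as [ThetaE] shows:
   a factor [(h, h)] cancels in [(h * g)^-1 * (h * f)]. *)
have [rep repK] := choice (@to_right_cosets_surj _ (diagonal_subgroup G)).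
pose Theta c := (rep c).1^-1 * (rep c).2.
have ThetaE g f :
    Theta (to_right_cosets (diagonal_subgroup G) (g, f)) = g^-1 * f.
  have [_ /diagonal_subgroupP[h _ <-] gf] := to_right_cosets_eq (repK
    (to_right_cosets (diagonal_subgroup G) (g, f))).
  by rewrite /Theta -gf /= invgM divgKA.
exists Theta; split=> //.
exists (fun x => to_right_cosets (diagonal_subgroup G) (1, x)); split.
- move=> c; have [[g f] <-] := to_right_cosets_surj c.
  by rewrite ThetaE to_right_cosets_diagonal.
- by move=> x; rewrite ThetaE invg1 mul1g.
- apply: quotient_coarse_controlled; first exact: coarse_structure_roelcke.
  suff -> : Theta \o to_right_cosets (diagonal_subgroup G) =
            (fun p => p.1^-1 * p.2) by exact: invmul_controlled.
  by apply/funext => -[g f]; exact: ThetaE.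
- exact: to_diagonal_cosets_controlled.
Qed.
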